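(* Let $m\in\mathbb{N}$, $\lambda_m=(m+\sqrt{m^2+4})/2$ and $\lambda_m'=m-\lambda_m$. Let $\Lambda_m\subset\mathbb{R}$ be a generating random noble means set. Then $\Lambda_m\subset\Theta(W_m)$ with $W_m:=[\lambda_m'-1,\,1-\lambda_m']$.
   Context: Random noble means substitution. Let $\boldsymbol{p}_m=(p_0,\dots,p_m)$ be a probability vector with all $p_j>0$ (standing assumption). On words over $\{\mathtt a,\mathtt b\}$, $\zeta_m$ maps $\mathtt a\mapsto \mathtt a^{i}\mathtt b\mathtt a^{m-i}$ with probability $p_i$ ($0\le i\le m$) and $\mathtt b\mapsto\mathtt a$; it is applied letter by letter, the image of each letter being chosen separately and independently, and the images are concatenated. Any possible outcome is called an image; images under $\zeta_m^k$ are obtained by iterating. Generating random noble means words. These are the elements of the set $X_m$ of all $w\in\{\mathtt a,\mathtt b\}^{\mathbb{Z}}$ (product topology) that are accumulation points of a sequence $(\zeta_m^k(\mathtt a|\mathtt a))_{k\in\mathbb{N}_0}$ of images of $\mathtt a|\mathtt a$, where $|$ marks the origin (between positions $-1$ and $0$) and finite words are regarded as embedded in $\{\mathtt a,\mathtt b\}^{\mathbb{Z}}$. Generating random noble means sets. These are the geometric realisations of generating random noble means words: each letter $\mathtt a$ is replaced by an interval of length $\lambda_m$ and each letter $\mathtt b$ by an interval of length $1$, the intervals being laid out consecutively along $\mathbb{R}$ according to the word, with the left endpoint of the interval of the letter at position $0$ placed at $0$; the set consists of all left endpoints of the intervals. Model sets. The cut and project scheme is $(\mathbb{R},\mathbb{R},\mathcal{L}_m)$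 with lattice $\mathcal{L}_m=\{(x,x'):x\in\mathbb{Z}[\lambda_m]\}$, where $x\mapsto x'$ is algebraic conjugation in $\mathbb{Q}(\sqrt{m^2+4})$ (so $\lambda_m\mapsto\lambda_m'$). For $W\subset\mathbb{R}$, $\Theta(W)=\{x\in\mathbb{Z}[\lambda_m] : x'\in W\}$. *)

(* Defs.v *)
From HB Require Import structures.
From mathcomp Require Import all_boot all_order all_algebra.
From mathcomp Require Import all_classical all_reals all_analysis.
Set Implicit Arguments.
Unset Strict Implicit.
Unset Printing Implicit Defensive.
Import Order.TTheory GRing.Theory Num.Theory.
Local Open Scope classical_set_scope.
Local Open Scope ring_scope.

(* Letters are booleans, so that [prod_topology (fun _ : int => bool)] is
   {a,b}^Z with the product of the discrete topologies. *)
Notation letter := bool (only parsing).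
Definition la : letter := true.
Definition lb : letter := false.
Definition word := seq letter.
Definition biword := prod_topology (fun _ : int => bool).

Section Substitution.
Variables (R : realType) (m : nat) (p : 'I_m.+1 -> R).

Definition letter_prob (x : letter) (v : word) : R :=
  if x == la then
    \sum_(i < m.+1 | nseq i la ++ lb :: nseq (m - i) la == v) p i
  else (v == [:: la])%:R.

(* The images of the letters being chosen independently, an outcome is possible
   iff each of the chosen letter images has positive probability. *)
Definition subst_image (w v : word) : Prop :=
  exists2 vs : seq word,
    all2 (fun x u => 0 < letter_prob x u) w vs & flatten vs = v.

Fixpoint iter_image (k : nat) (w v : word) : Prop :=
  if k is k'.+1 then exists2 u, iter_image k' w u & subst_image u v else v = w.

(* The pair (u, v) stands for the marked word u|v: [v] is read from position 0
   to the right and [u] from position -1 to the left ([Negz j] is -(j+1)). The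
   letters outside the finite word are left arbitrary. *)
Definition embeds (x : biword) (uv : word * word) : Prop :=
  (forall j, (j < size uv.2)%N -> x (Posz j) = nth la uv.2 j) /\
  (forall j, (j < size uv.1)%N -> x (Negz j) = nth la (rev uv.1) j).

Definition generating_words : set biword :=
  [set w | exists (uv : nat -> word * word) (x : nat -> biword),
    [/\ forall k, iter_image k [:: la] (uv k).1 /\
                  iter_image k [:: la] (uv k).2,
        forall k, embeds (x k) (uv k)
      & cluster (x @ \oo) w]].

End Substitution.

Section Geometry.
Variables (R : realType) (m : nat).

Definition surd : R := Num.sqrt (m%:R ^+ 2 + 4).
Definition lambda : R := (m%:R + surd) / 2.
Definition lambda' : R := m%:R - lambda.

Definition len (x : letter) : R := if x == la then lambda else 1.

Definition left_endpoint (w : biword) (n : int) : R :=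
  match n with
  | Posz k => \sum_(i < k) len (w (Posz i))
  | Negz k => - \sum_(i < k.+1) len (w (Negz i))
  end.

Definition realisation (w : biword) : set R := range (left_endpoint w).

Definition generating_sets (p : 'I_m.+1 -> R) : set (set R) :=
  [set realisation w | w in generating_words p].

Definition Zlambda : set R :=
  [set x | exists q : {poly int}, x = (map_poly intr q).[lambda]].

(* Algebraic conjugation of Q(sqrt (m^2 + 4)), extended by 0 outside the field;
   [star_surd] below shows that it is well defined for m > 0. *)
Definition star (x : R) : R :=
  xget 0 [set y | exists r s : rat,
    x = ratr r + ratr s * surd /\ y = ratr r - ratr s * surd].

Definition Theta (W : set R) : set R := [set x | Zlambda x /\ W (star x)].

Lemma surd_irrational (q : rat) : (0 < m)%N -> surd <> ratr q.
Proof.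
move=> m0 eq.
have d0 : 0 <= m%:R ^+ 2 + 4 :> R by rewrite addr_ge0 ?exprn_ge0.
have : (m ^ 2 + 4)%:R = q ^+ 2.
  apply: (fmorph_inj (@ratr R)).
  by rewrite rmorphXn /= -eq sqr_sqrtr // ratr_nat natrD natrX.
move=> qE.
have {qE} nE : numq q ^+ 2 = (m ^ 2 + 4)%:Z * denq q ^+ 2.
  apply/eqP; rewrite -(eqr_int rat) intrM !rmorphXn /=.
  by rewrite numqE exprMn -qE pmulrn.
have {}nE : (`|numq q| ^ 2 = (m ^ 2 + 4) * `|denq q| ^ 2)%N.
  by have := congr1 absz nE; rewrite abszM !abszX absz_nat.
have d1 : `|denq q|%N = 1%N.
  apply/eqP; rewrite -dvdn1 -(eqnP (coprime_num_den q)) dvdn_gcd dvdnn andbT.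
  by rewrite -(dvdn_pexp2r _ _ (isT : (0 < 2)%N)) nE dvdn_mull.
move: nE; rewrite d1 exp1n muln1; move: `|numq q|%N => n nE.
have mn : (m < n)%N by rewrite -(@ltn_exp2r _ _ 2) // nE -addn1 leq_add2l.
have : (n < m.+2)%N.
  by rewrite -(@ltn_exp2r _ _ 2) // nE -(addn2 m) sqrnD -addnA
    ltn_add2l -[X in (X < _)%N]addn0 ltn_add2l !muln_gt0 m0.
rewrite ltnS => nm.
have nm1 : n = m.+1 by apply/eqP; rewrite eqn_leq nm mn.
move: nE; rewrite nm1 -addn1 sqrnD => /eqP.
by rewrite -addnA eqn_add2l muln1 => /eqP /(congr1 odd); rewrite oddD oddM.
Qed.

Lemma star_surd (r s : rat) : (0 < m)%N ->
  star (ratr r + ratr s * surd) = ratr r - ratr s * surd.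
Proof.
move=> m0; apply: xget_unique => [|y [r' [s' [e ->]]]]; first by exists r, s.
have [ss|ss] := eqVneq s s'.
  by move: e; rewrite ss => /addIr ->.
exfalso; apply: (@surd_irrational ((r' - r) / (s - s')) m0).
have ss0 : ratr (s - s') != 0 :> R by rewrite fmorph_eq0 subr_eq0.
rewrite fmorph_div; apply: (mulIf ss0); rewrite divfK //.
rewrite !rmorphB /= mulrBr ![surd * _]mulrC.
by apply: (addrI (ratr r)); rewrite addrA e addrK addrC subrK.
Qed.

Lemma star_lambda : (0 < m)%N -> star lambda = lambda'.
Proof.
move=> m0.
have lE : lambda = ratr (m%:R / 2) + ratr (1 / 2) * surd.
  by rewrite !fmorph_div rmorph1 /= !ratr_nat /lambda mulrDl mul1r (mulrC surd).
rewrite lE star_surd // /lambda' lE opprD addrA; congr (_ - _).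
have -> : m%:R = ratr (m%:R / 2) *+ 2 :> R.
  by rewrite fmorph_div /= !ratr_nat -[RHS]mulr_natr divfK.
by rewrite mulr2n addrK.
Qed.

End Geometry.

(* Main.v *)
(* Under conjugation a prefix u of an image of v becomes
   star_length u = lambda' * star_length v0 + star_length r, where v0 is a
   prefix of v and r a proper prefix of the image of the letter following v0.
   As -1 < lambda' < 0, this keeps the conjugated prefix lengths in the window.
   Images of a are closed under reversal and the window is symmetric, which
   covers the positions to the left of the origin.  An accumulation point
   agrees on any finite range of positions with some pair of images. *)
Require Import Defs.
From mathcomp Require Import all_boot all_order all_algebra.
From mathcomp Require Import all_classical all_reals all_analysis.
From mathcomp Require Import ring lra zify.
Set Implicit Arguments.
Unset Strict Implicit.
Unset Printing Implicit Defensive.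
Import Order.TTheory GRing.Theory Num.Theory.
Local Open Scope classical_set_scope.
Local Open Scope ring_scope.

Section Conjugate.
Variables (R : realType) (m : nat).
Hypothesis m_gt0 : (0 < m)%N.

Local Notation lambda := (lambda R m).
Local Notation lambda' := (lambda' R m).

(** * Conjugated lengths and the window *)

Definition star_len (x : bool) : R := if x == la then lambda' else 1.

Definition star_length (w : word) : R := \sum_(x <- w) star_len x.

Definition in_window (h : R) : bool := lambda' - 1 <= h <= 1 - lambda'.

Lemma lambda'_sqr : lambda' ^+ 2 = m%:R * lambda' + 1.
Proof.
have d0 : 0 <= m%:R ^+ 2 + 4 :> R by rewrite addr_ge0 ?exprn_ge0.
have := sqr_sqrtr d0; rewrite -/(surd R m) /Defs.lambda' /Defs.lambda => sE.
by field: sE.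
Qed.

(** As [lambda'] is half of m - [surd], this amounts to m < [surd] < m + 2, where the square of
    [surd] is m^2 + 4 and m > 0. *)
Lemma lambda'_bounds : -1 < lambda' < 0.
Proof.
have d0 : 0 <= m%:R ^+ 2 + 4 :> R by rewrite addr_ge0 ?exprn_ge0.
have sE := sqr_sqrtr d0.
have s0 := sqrtr_ge0 (m%:R ^+ 2 + 4 : R).
have m1 : 1 <= m%:R :> R by rewrite ler1n.
rewrite /Defs.lambda' /Defs.lambda; move: sE s0; rewrite -/(surd R m).
move: (surd R m) (m%:R : R) m1 => s t t1 sE s0.
by apply/andP; split; nra.
Qed.

Lemma star_Zlambda (a b : int) :
  star m (a%:~R + b%:~R * lambda) = a%:~R + b%:~R * lambda'.
Proof.
(* [star] is known on rational combinations of 1 and [surd], hence the change of basis. *)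
have lE : a%:~R + b%:~R * lambda =
    ratr (a%:~R + b%:~R * (m%:R / 2)) + ratr (b%:~R / 2) * surd R m.
  rewrite rmorphD rmorphM !fmorph_div /= !ratr_int !ratr_nat /Defs.lambda.
  by field.
rewrite lE star_surd // rmorphD rmorphM !fmorph_div /= !ratr_int !ratr_nat.
by rewrite /Defs.lambda' /Defs.lambda; field.
Qed.

Lemma Zlambda_linear (a b : int) : Zlambda m (a%:~R + b%:~R * lambda).
Proof.
exists (a%:P + b *: 'X).
by rewrite rmorphD /= map_polyC map_polyZ map_polyX /= !hornerE.
Qed.

(** [a] counts the letters [lb] and [b] the letters [la]; as both sums share these integers,
    [star_length w] is the conjugate of the length of [w]. *)
Lemma star_sum_len (w : word) : exists a b : int,
  \sum_(x <- w) len R m x = a%:~R + b%:~R * lambda /\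
  star_length w = a%:~R + b%:~R * lambda'.
Proof.
elim: w => [|x w [a [b [IH1 IH2]]]].
  by exists 0, 0; rewrite /star_length !big_nil !mul0r !addr0.
rewrite /star_length !big_cons -/(star_length w) IH1 IH2 /len /star_len.
case: (x == la).
  by exists a, (b + 1); rewrite !rmorphD /=; split; ring.
by exists (a + 1), b; rewrite !rmorphD /=; split; ring.
Qed.

Lemma in_windowN h : in_window (- h) = in_window h.
Proof. by rewrite /in_window lerNr lerNl opprB andbC opprB. Qed.

Lemma Theta_sum_len (w : word) : in_window (star_length w) ->
  Theta m `[lambda' - 1, 1 - lambda'] (\sum_(x <- w) len R m x).
Proof.
have [a [b [-> ->]]] := star_sum_len w => ww.
split; first exact: Zlambda_linear.
by rewrite star_Zlambda /= in_itv.
Qed.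

Lemma Theta_opp_sum_len (w : word) : in_window (star_length w) ->
  Theta m `[lambda' - 1, 1 - lambda'] (- \sum_(x <- w) len R m x).
Proof.
have [a [b [-> ->]]] := star_sum_len w; rewrite -in_windowN => ww.
have oE c : - (a%:~R + b%:~R * c) = (- a)%:~R + (- b)%:~R * c :> R.
  by rewrite !rmorphN mulNr opprD.
rewrite oE; split; first exact: Zlambda_linear.
by rewrite star_Zlambda /= in_itv -oE.
Qed.

Lemma star_length_cat u v :
  star_length (u ++ v) = star_length u + star_length v.
Proof. exact: big_cat. Qed.

Lemma star_length_nseq n : star_length (nseq n la) = n%:R * lambda'.
Proof. by rewrite /star_length big_nseq iter_addr_0 mulr_natl. Qed.

(** * Conjugated lengths of prefixes of images *)

Variable p : 'I_m.+1 -> R.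

Lemma letter_prob_gt0 x u : 0 < letter_prob p x u ->
  if x then exists2 i, (i <= m)%N & u = nseq i la ++ lb :: nseq (m - i) la
  else u = [:: la].
Proof.
case: x; rewrite /letter_prob /=; last first.
  by case: eqP => // _; rewrite ltxx.
have [[i /eqP <-] _|no] :=
  pselect (exists i : 'I_m.+1, nseq i la ++ lb :: nseq (m - i) la == u).
  by exists i => //; rewrite -ltnS.
by rewrite big_pred0 ?ltxx // => i; apply/negP => iu; apply: no; exists i.
Qed.

(** The conjugated letter lengths form an eigenvector of the substitution matrix for [lambda']; for
    the letter a this is [lambda'_sqr]. *)
Lemma star_length_letter_image x u : 0 < letter_prob p x u ->
  star_length u = lambda' * star_len x.
Proof.
move/letter_prob_gt0; case: x => [[i im ->]|->]; last first.
  by rewrite /star_length big_seq1 /star_len /= mulr1.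
rewrite star_length_cat -cat1s star_length_cat !star_length_nseq.
rewrite /star_length big_seq1 /star_len /= -expr2 lambda'_sqr natrB //; ring.
Qed.

(* Assuming only that [h] lies in the window is not enough: when [u] starts with
   [b], the upper bound needs [-1 <= h], which is the lower bound on the height
   [h + lambda'] reached after the letter [a]. *)
Lemma in_window_letter_image x u h k : 0 < letter_prob p x u ->
  in_window h -> in_window (h + star_len x) -> (k < size u)%N ->
  in_window (lambda' * h + star_length (take k u)).
Proof.
move=> /letter_prob_gt0; rewrite /in_window => xu /andP[h1 h2] /andP[h3 h4].
have := lambda'_sqr; have /andP[l1 l2] := lambda'_bounds => l3.
case: x xu h3 h4 => [[i im ->] h3 h4|-> _ _]; last first.
  case: k => // _; rewrite take0 /star_length big_nil addr0.
  by apply/andP; split; nra.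
have {}h3 : -1 <= h by move: h3; rewrite /star_len /=; lra.
rewrite size_cat /= !size_nseq => km.
(* By [lambda'_sqr], m * lambda' = lambda'^2 - 1, so at h = 1 - lambda' the value lambda' * h + m *
   lambda' is exactly the lower end lambda' - 1. *)
have bnd (t : nat) : (t <= m)%N -> m%:R * lambda' <= t%:R * lambda' <= 0.
  rewrite -(ler_nat R) => tm; have t0 : 0 <= t%:R :> R by exact: ler0n.
  by apply/andP; split; nra.
(* The cut falls inside the first run of a, right before b, or after b. *)
rewrite take_cat size_nseq; case: ltnP => ki.
  rewrite take_nseq ?star_length_nseq; last exact: ltnW.
  have /bnd : (k <= m)%N by lia.
  by case/andP=> ??; apply/andP; split; nra.
case kiE : (k - i)%N => [|j] /=.
  rewrite cats0 star_length_nseq.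
  by have /andP[??] := bnd _ im; apply/andP; split; nra.
rewrite take_nseq; last by lia.
rewrite star_length_cat -cat1s star_length_cat !star_length_nseq.
rewrite /star_length big_seq1 /star_len /=.
have /bnd : (i + j <= m)%N by lia.
by rewrite natrD mulrDl => /andP[??]; apply/andP; split; nra.
Qed.

Lemma in_window0 : in_window 0.
Proof.
by have /andP[??] := lambda'_bounds; rewrite /in_window; apply/andP; split; lra.
Qed.

Lemma in_windowM h : in_window h -> in_window (lambda' * h).
Proof.
have /andP[l1 l2] := lambda'_bounds; rewrite /in_window => /andP[h1 h2].
by apply/andP; split; nra.
Qed.

(** The offset [h] carries the induction on [w]: passing a letter [x] adds [star_len x] to [h], and
    its image adds [lambda'] times that on the other side. *)
Lemma in_window_prefix_image_from h w vs k :
  all2 (fun x u => 0 < letter_prob p x u) w vs ->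
  (forall j, in_window (h + star_length (take j w))) ->
  in_window (lambda' * h + star_length (take k (flatten vs))).
Proof.
elim: w vs h k => [|x w IH] [|u vs] // h k.
  by move=> _ /(_ 0); rewrite /= /star_length !big_nil !addr0 => /in_windowM.
case/andP=> xu /IH{}IH hw /=.
have h0 : in_window h by have := hw 0; rewrite /star_length big_nil addr0.
have take_cons j : star_length (take j.+1 (x :: w)) =
    star_len x + star_length (take j w) by rewrite /star_length big_cons.
have h1 : in_window (h + star_len x).
  by have := hw 1; rewrite take_cons take0 /star_length big_nil addr0.
rewrite take_cat; case: ltnP => ku; first exact: (in_window_letter_image xu).
rewrite star_length_cat (star_length_letter_image xu) addrA -mulrDr.
by apply: IH => j; rewrite -addrA -take_cons.
Qed.

Lemma in_window_prefix_image w v : subst_image p w v ->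
  (forall k, in_window (star_length (take k w))) ->
  forall k, in_window (star_length (take k v)).
Proof.
move=> [vs wvs <-] ww k.
have := @in_window_prefix_image_from 0 w vs k wvs.
by rewrite mulr0 add0r; apply=> j; rewrite add0r.
Qed.

Lemma in_window_prefix_iter_image n v k :
  iter_image p n [:: la] v -> in_window (star_length (take k v)).
Proof.
elim: n v k => [|n IH] v k /=.
  move=> ->; case: k => [|k] /=; rewrite /star_length ?big_nil ?in_window0 //.
  have /andP[l1 l2] := lambda'_bounds; rewrite big_seq1 /star_len /in_window /=.
  by apply/andP; split; lra.
by case=> u /IH{}IH /in_window_prefix_image; apply.
Qed.

(** * Reversal and growth of images *)

Hypothesis p_gt0 : forall i, 0 < p i.

(** Reversal exchanges the indices i and m - i, and both have positive probability. *)
Lemma letter_prob_rev_gt0 x u :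
  0 < letter_prob p x u -> 0 < letter_prob p x (rev u).
Proof.
move=> /[dup] xu /letter_prob_gt0; case: x xu => [_ [i im ->]|xu uE]; last first.
  by move: xu; rewrite uE.
have rE : rev (nseq i la ++ lb :: nseq (m - i) la) =
    nseq (m - i) la ++ lb :: nseq (m - (m - i)) la.
  by rewrite rev_cat rev_cons !rev_nseq cat_rcons subKn.
have mi : (m - i < m.+1)%N by rewrite ltnS leq_subr.
rewrite rE /letter_prob /= (bigD1 (Ordinal mi)) //=.
by apply: ltr_pwDl => //; apply: sumr_ge0 => j _; exact: ltW.
Qed.

Lemma subst_image_rev w v : subst_image p w v -> subst_image p (rev w) (rev v).
Proof.
case=> vs + <-; elim: w vs => [|x w IH] [|u vs] //=; first by exists [::].
case/andP=> /letter_prob_rev_gt0 xu /IH[vs' wvs' rE].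
exists (rcons vs' (rev u)); last by rewrite flatten_rcons rE rev_cat.
move: wvs'; rewrite !all2E rev_cons !size_rcons eqSS.
case/andP=> /[dup] sz -> wvs'.
by rewrite zip_rcons ?(eqP sz) // all_rcons /= xu.
Qed.

Lemma iter_image_rev n v :
  iter_image p n [:: la] v -> iter_image p n [:: la] (rev v).
Proof.
elim: n v => [|n IH] v /=; first by move->.
by case=> u /IH{}IH /subst_image_rev; exists (rev u).
Qed.

(** The image of a has m + 1 > 1 letters, m of them a, and that of b has one; so a letter a survives
    and forces strict growth at each step. *)
Lemma iter_image_size n v :
  iter_image p n [:: la] v -> la \in v /\ (n < size v)%N.
Proof.
suff grow w u : subst_image p w u -> (size w <= size u)%N /\
    (la \in w -> la \in u /\ (size w < size u)%N).
  elim: n v => [|n IH] v /=; first by move->.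
  case=> w /IH[law nw] /grow[_ /(_ law)[-> wu]]; split=> //.
  exact: leq_ltn_trans wu.
case=> vs + <-; elim: w vs => [|x w IH] [|y vs] //=.
case/andP=> /letter_prob_gt0 xy /IH[le_w la_w].
rewrite in_cons size_cat mem_cat; case: x xy => [[i im ->]|->].
  rewrite size_cat /= !size_nseq mem_cat in_cons !mem_nseq /=.
  split; [lia|move=> _; split; last lia].
  by rewrite !eqxx !andbT; lia.
rewrite /= add1n ltnS; split=> // {}/la_w[_ lt_w].
by split; rewrite ?lt_w.
Qed.

End Conjugate.

(** * Accumulation points in the product topology *)

Lemma nbhs_biword_agree (w : biword) (n : nat) :
  \forall y \near w, forall j, (j < n)%N ->
    y (Posz j) = w (Posz j) /\ y (Negz j) = w (Negz j).
Proof.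
(* Projections are continuous and singletons of [bool] are open; only finitely many positions are
   then intersected. *)
have agree1 (i : int) : \forall y \near w, y i = w i.
  have := @proj_continuous int (fun=> bool) i w [set w i].
  by apply; exact: discrete_set1.
have agree (j : 'I_n) : \forall y \near w,
    y (Posz j) = w (Posz j) /\ y (Negz j) = w (Negz j).
  by apply: filterI; exact: agree1.
have Fw : Filter (nbhs w) :=
  @nbhs_filter (prod_topology (fun _ : int => bool)) w.
have all_agree := filter_forall Fw agree.
by apply: filterS all_agree => y yw j jn; exact: (yw (Ordinal jn)).
Qed.

Lemma generating_words_prefix (R : realType) (m : nat) (p : 'I_m.+1 -> R)
    (w : biword) (n : nat) : (0 < m)%N -> generating_words p w ->
  exists k (u v : word),
  [/\ iter_image p k [:: la] u, iter_image p k [:: la] v,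
      take n v = [seq w (Posz j) | j <- iota 0 n] &
      take n (rev u) = [seq w (Negz j) | j <- iota 0 n]].
Proof.
move=> m_gt0 [uv [x [im emb cl]]].
(* From [k >= n] on both words have more than [n] letters, so the compared positions avoid the
   arbitrary letters allowed by [embeds]. *)
have large : \forall y \near x @ \oo, exists2 k, (n <= k)%N & x k = y.
  by apply: filterS (nbhs_infty_ge n) => k nk; exists k.
have [_ [[k nk <-] agree]] := cl _ _ large (nbhs_biword_agree w n).
have [imu imv] := im k; have [embv embu] := emb k.
exists k, (uv k).1, (uv k).2.
have [_ /(leq_ltn_trans nk)/ltnW nu] := iter_image_size m_gt0 imu.
have [_ /(leq_ltn_trans nk)/ltnW nv] := iter_image_size m_gt0 imv.
split=> //; apply: (@eq_from_nth _ la);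
  rewrite ?size_takel ?size_map ?size_iota ?size_rev // => j jn;
  rewrite nth_take // (nth_map 0) ?size_iota // nth_iota // add0n.
  by rewrite -embv ?(leq_trans jn) //; have [] := agree _ jn.
by rewrite -embu ?(leq_trans jn) //; have [] := agree _ jn.
Qed.

Unset Implicit Arguments.

Theorem proposition5p1 (R : realType) (m : nat) (p : 'I_m.+1 -> R)
    (Lambda : set R) :
  (0 < m)%N ->
  (forall i, 0 < p i) -> \sum_(i < m.+1) p i = 1 ->
  generating_sets p Lambda ->
  Lambda `<=` Theta m `[lambda' R m - 1, 1 - lambda' R m].
Proof.
move=> m_gt0 p_gt0 _ [w gw <-] _ [[n|n] _ <-] /=.
  have [k [u [v [_ /in_window_prefix_iter_image vW + _]]]] :=
    generating_words_prefix n m_gt0 gw.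
  have -> : \sum_(i < n) len R m (w i) =
      \sum_(x <- [seq w (Posz j) | j <- iota 0 n]) len R m x.
    rewrite big_map -(big_mkord xpredT (fun i => len R m (w i))).
    by rewrite /index_iota subn0.
  by move=> <-; apply: Theta_sum_len => //; exact: vW.
(* [Negz n] is -(n + 1), so n + 1 letters are passed leftwards; they form a prefix of [rev u], which
   is again an image of a. *)
have [k [u [v [imu _ _]]]] := generating_words_prefix n.+1 m_gt0 gw.
have uW := in_window_prefix_iter_image m_gt0 _ (iter_image_rev p_gt0 imu).
have -> : \sum_(i < n.+1) len R m (w (Negz i)) =
    \sum_(x <- [seq w (Negz j) | j <- iota 0 n.+1]) len R m x.
  rewrite big_map -(big_mkord xpredT (fun i => len R m (w (Negz i)))).
  by rewrite /index_iota subn0.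
by move=> <-; apply: Theta_opp_sum_len => //; exact: uW.
Qed.
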